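(* Let $m$ be a positive integer and let $\alpha=(\alpha_{k+m})_{k\in\mathbb N}$ be a sequence in a commutative ring $R$ without any zeroes or divisors of zero (i.e. no $\alpha_{k+m}$ is zero or a zero divisor). Let $(P_n(x))_{n\in\mathbb N}$ be the monic $m$-orthogonal polynomial sequence with respect to the vectors of linear functionals $(u_0,\dots,u_{m-1})$ and $(v_0,\dots,v_{m-1})$ on $R[x]$ such that $$u_k[x^n]=S^{(m)}_{n,k}(\alpha)\quad\text{and}\quad v_k[x^n]=S^{(m;k)}_n(\alpha)\qquad\text{for all }n\in\mathbb N\text{ and }0\leq k\leq m-1.$$ Then $(P_n(x))_{n\in\mathbb N}$ satisfies the recurrence relation $$P_{n+1}(x)=x\,P_n(x)-\sum_{k=0}^{\min(m,n)}\gamma^{[k]}_{n-k}\,P_{n-k}(x),$$ with initial condition $P_0(x)=1$ and coefficients $$\gamma^{[k]}_n=\sum_{m\geq\ell_0>\cdots>\ell_k\geq 0}\ \prod_{j=0}^{k}\alpha_{(m+1)(n+j)+\ell_j}\qquad\text{for any }n\in\mathbb N\text{ and }0\leq k\leq m,$$ where $\alpha_j=0$ for $0\leq j\leq m-1$.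
   Context: $\mathbb N=\{0,1,2,\dots\}$. A partial $m$-Dyck path is a finite path in $\mathbb N\times\mathbb N$ using steps $(1,1)$ (rises) and $(1,-m)$ ($m$-falls), allowed to start and end anywhere in $\mathbb N\times\mathbb N$. Each rise gets weight $1$ and each $m$-fall from height $i$ gets weight $\alpha_i$; the weight of a path is the product of the weights of its steps. The generalised $m$-Stieltjes-Rogers polynomial $S^{(m)}_{n,k}(\alpha)$ is the sum of the weights of the partial $m$-Dyck paths from $(0,0)$ to $((m+1)n,(m+1)k)$. The modified $m$-Stieltjes-Rogers polynomial of type $j$, $S^{(m;j)}_{n}(\alpha)$, is the sum of the weights of the partial $m$-Dyck paths from $(0,0)$ to $((m+1)n+j,j)$. A linear functional on $R[x]$ is an $R$-linear map $u:R[x]\to R$; its value on $f$ is written $u[f]$. For $d\ge 1$, a sequence $(P_n(x))_{n\in\mathbb N}$ of monic polynomials with $\deg P_n=n$ is $d$-orthogonal with respect to $(u_0,\dots,u_{d-1})$ if, for all $j\in\{0,\dots,d-1\}$ and $k,n\in\mathbb N$, $u_j[x^kP_n]\neq0$ if $n=dk+j$ and $u_j[x^kP_n]=0$ if $n\geq dk+j+1$. *)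

(* Defs.v *)
From mathcomp Require Import all_boot all_order all_algebra.

Set Implicit Arguments.
Unset Strict Implicit.
Unset Printing Implicit Defensive.

Import GRing.Theory.
Local Open Scope ring_scope.

(* A partial m-Dyck path is encoded by its starting point p in N x N and its
   word of steps: [true] is a rise (1, 1), [false] is an m-fall (1, -m).
   [mdyck m p q w] holds when the path starting at p with steps w stays in
   N x N and ends at q. *)
Fixpoint mdyck (m : nat) (p q : nat * nat) (w : seq bool) : bool :=
  match w with
  | [::] => p == q
  | true :: w' => mdyck m (p.1.+1, p.2.+1)%N q w'
  | false :: w' => (m <= p.2)%N && mdyck m (p.1.+1, (p.2 - m)%N) q w'
  end.

Lemma mdyck_size m p q w : mdyck m p q w -> q.1 = (p.1 + size w)%N.
Proof.
elim: w p => [|[] w IHw] p /=; first by move/eqP->; rewrite addn0.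
  by move/IHw->; rewrite addnS.
by case/andP=> _ /IHw->; rewrite addnS.
Qed.

(* Product of the step weights of the path with steps w starting at height h:
   1 for a rise, alpha i for an m-fall from height i. *)
Fixpoint mdyck_weight (R : comNzRingType) (m : nat) (alpha : nat -> R)
    (h : nat) (w : seq bool) : R :=
  match w with
  | [::] => 1
  | true :: w' => 1 * mdyck_weight m alpha h.+1 w'
  | false :: w' => alpha h * mdyck_weight m alpha (h - m)%N w'
  end.

(* Sum over all partial m-Dyck paths from p to q. By [mdyck_size] such a path
   has exactly q.1 - p.1 steps, so that the sum ranges over a finite type. *)
Definition mdyck_sum (R : comNzRingType) (m : nat) (alpha : nat -> R)
    (p q : nat * nat) : R :=
  \sum_(w : (q.1 - p.1).-tuple bool | mdyck m p q w)
     mdyck_weight m alpha p.2 w.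

Definition gen_stieltjes_rogers (R : comNzRingType) (m : nat)
    (alpha : nat -> R) (n k : nat) : R :=
  mdyck_sum m alpha (0, 0)%N (m.+1 * n, m.+1 * k)%N.

Definition mod_stieltjes_rogers (R : comNzRingType) (m j : nat)
    (alpha : nat -> R) (n : nat) : R :=
  mdyck_sum m alpha (0, 0)%N (m.+1 * n + j, j)%N.

(* A linear functional on R[x] is an element of {scalar {poly R}}. Recall that
   [size p = n.+1] means that p has degree n. *)
Definition d_orthogonal (R : comNzRingType) (d : nat)
    (u : 'I_d -> {scalar {poly R}}) (P : nat -> {poly R}) : Prop :=
  (forall n, P n \is monic /\ size (P n) = n.+1) /\
  (forall (j : 'I_d) (k n : nat),
     (n = (d * k + j)%N -> u j ('X^k * P n) <> 0) /\
     ((d * k + j + 1 <= n)%N -> u j ('X^k * P n) = 0)).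

(* gamma m alpha k n is gamma^{[k]}_n; the sum ranges over the strictly
   decreasing tuples m >= l_0 > ... > l_k >= 0. *)
Definition gamma (R : comNzRingType) (m : nat) (alpha : nat -> R)
    (k n : nat) : R :=
  \sum_(l : {ffun 'I_k.+1 -> 'I_m.+1}
         | [forall i : 'I_k.+1, forall j : 'I_k.+1, ((i < j) ==> (l j < l i))%N])
     \prod_(j < k.+1) alpha (m.+1 * (n + j) + l j)%N.

(* Main.v *)
(* Let E_0 = 1 and t E_h = E_(h+1) + alpha_h E_(h-m): multiplication by t acts on
   the E_h as one step acts on the height h. Each E_h is a power of t times a
   polynomial in x = t^(m+1), and we set Q_n(x) = E_((m+1)n)(t). Expanding m+1
   consecutive multiplications by t over the positions of the m-falls gives the
   recurrence for Q_n with coefficients gamma. On the other hand u_j[x^k Q_n] is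
   the weight sum of the paths from height (m+1)n to height (m+1)j with (m+1)k
   steps: it vanishes if n > mk + j, and if n = mk + j there is a single path,
   made of falls only, with regular weight. Orthogonality with respect to u is
   then a triangular system with regular diagonal, so P_n = Q_n. *)
Require Import Defs.
From mathcomp Require Import all_boot all_order all_algebra.
From mathcomp Require Import zify.

Set Implicit Arguments.
Unset Strict Implicit.
Unset Printing Implicit Defensive.

Import GRing.Theory.
Local Open Scope ring_scope.

(** * Weight sums of paths by length and end heights *)

Section PathSums.

Variables (R : comNzRingType) (m : nat) (alpha : nat -> R).

(* The term for a fall truncates h - m when h < m, where alpha h will be 0. *)
Fixpoint path_sum (s h t : nat) : R :=
  if s is s'.+1 then path_sum s' h.+1 t + alpha h * path_sum s' (h - m) t
  else (h == t)%:R.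

Lemma big_tuple_bool s (p : pred (seq bool)) (F : seq bool -> R) :
  \sum_(w : s.+1.-tuple bool | p w) F w
  = \sum_(w : s.-tuple bool | p (true :: w)) F (true :: w)
    + \sum_(w : s.-tuple bool | p (false :: w)) F (false :: w).
Proof.
rewrite (reindex (fun bw : bool * s.-tuple bool => [tuple of bw.1 :: bw.2])).
  transitivity (\sum_(b : bool) \sum_(w : s.-tuple bool | p (b :: w)) F (b :: w)).
    by rewrite pair_big_dep.
  by rewrite big_bool.
exists (fun w : s.+1.-tuple bool => (thead w, [tuple of behead w])).
  by case=> b w _; congr pair; apply: val_inj.
by move=> w _; case/tupleP: w => b w; apply: val_inj.
Qed.

Lemma path_sum_small s h t : (t + m * s < h)%N -> path_sum s h t = 0.
Proof.
elim: s h => [|s IHs] h lth /=; first by case: eqP => // eqht; exfalso; lia.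
by rewrite !IHs ?mulr0 ?addr0 //; nia.
Qed.

Hypothesis alpha_init : forall j : nat, (j < m)%N -> alpha j = 0.

(** A fall from a height below [m] is forbidden on the left and has weight 0 on the right. *)
Lemma sum_mdyck_weight s a b h t : b = (a + s)%N ->
  \sum_(w : s.-tuple bool | mdyck m (a, h) (b, t) w) mdyck_weight m alpha h w
  = path_sum s h t.
Proof.
elim: s a h => [|s IHs] a h def_b.
  rewrite /= def_b addn0; case: (eqVneq h t) => [->|neq_ht].
    by rewrite (big_pred1 [tuple]) // => w; rewrite tuple0 /= eqxx.
  by rewrite big_pred0 // => w; rewrite tuple0 /= xpair_eqE (negPf neq_ht) andbF.
rewrite (big_tuple_bool _ (mdyck m (a, h) (b, t)) (mdyck_weight m alpha h)) /=.
under eq_bigr do rewrite mul1r.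
rewrite IHs; last by rewrite def_b addnS.
congr (_ + _); case: (leqP m h) => [le_mh | lt_hm].
  by rewrite -big_distrr /= IHs // def_b addnS.
by rewrite big_pred0_eq alpha_init // mul0r.
Qed.

Lemma mdyck_sumE p q : (p.1 <= q.1)%N ->
  mdyck_sum m alpha p q = path_sum (q.1 - p.1) p.2 q.2.
Proof. by case: p q => [a h] [b t] /= leab; apply: sum_mdyck_weight; rewrite subnKC. Qed.

Hypothesis alpha_reg : forall k : nat, GRing.lreg (alpha (k + m)%N).

(** Only the path made of falls descends by [m * s] in [s] steps; its falls start at heights at
    least [m], where the weights are regular. *)
Lemma path_sum_lreg s t : GRing.lreg (path_sum s (t + m * s) t).
Proof.
elim: s => [|s IHs] /=; first by rewrite muln0 addn0 eqxx; apply: lreg1.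
rewrite path_sum_small; last by nia.
by rewrite add0r mulnSr addnA addnK; apply: lregM => //.
Qed.

End PathSums.

(** * Strictly decreasing tuples and the coefficients gamma *)

Section ChainSums.

Variables (R : comNzRingType) (m : nat) (alpha : nat -> R).

(* Sum over L > l_0 > ... > l_(k-1) >= 0, recursive in the largest entry a = l_0;
   removing it shifts n because l_j is paired with n + j. *)
Fixpoint chain_sum (k L n : nat) : R :=
  if k is k'.+1
  then \sum_(a < L) alpha (m.+1 * n + a)%N * chain_sum k' a n.+1
  else 1.

Lemma chain_sumSS k L n :
  chain_sum k.+1 L.+1 n
  = chain_sum k.+1 L n + alpha (m.+1 * n + L)%N * chain_sum k L n.+1.
Proof. by rewrite /= big_ord_recr. Qed.

Lemma chain_sum_small k L n : (L < k)%N -> chain_sum k L n = 0.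
Proof.
elim: k L n => [|k IHk] //= L n ltLk.
apply: big1 => a _; rewrite IHk ?mulr0 //; have := ltn_ord a; lia.
Qed.

Let decreasing k (l : {ffun 'I_k -> 'I_m.+1}) :=
  [forall i : 'I_k, forall j : 'I_k, ((i < j) ==> (l j < l i))%N].

Let ffcons k (T : Type) (p : T * {ffun 'I_k -> T}) : {ffun 'I_k.+1 -> T} :=
  [ffun i => oapp p.2 p.1 (unlift ord0 i)].

(** Splitting off the largest entry [a] leaves a tail bounded by [a], so the induction needs a bound
    [L] separate from the codomain ['I_m.+1]. *)
Lemma sum_decreasing k L n : (L <= m.+1)%N ->
  \sum_(l : {ffun 'I_k -> 'I_m.+1} | [forall i, (l i < L)%N] && decreasing l)
     \prod_(j < k) alpha (m.+1 * (n + j) + l j)%N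
  = chain_sum k L n.
Proof.
elim: k L n => [|k IHk] L n leL.
  rewrite (big_pred1 [ffun=> ord0]) => [|l]; first by rewrite big_ord0.
  have ->: l = [ffun=> ord0] by apply/ffunP; case.
  by rewrite /= eqxx; apply/andP; split; apply/forallP; case.
rewrite (reindex (@ffcons k _)); last first.
  exists (fun f : {ffun 'I_k.+1 -> 'I_m.+1} => (f ord0, [ffun i => f (lift ord0 i)])).
    case=> a l _; congr pair; first by rewrite ffunE unlift_none.
    by apply/ffunP => i; rewrite !ffunE liftK.
  by move=> f _; apply/ffunP => i; rewrite ffunE; case: unliftP => [j|] -> /=;
    rewrite ?ffunE.
rewrite /= (big_ord_widen m.+1
  (fun a => alpha (m.+1 * n + a)%N * chain_sum k a n.+1) leL).
transitivity (\sum_(a < m.+1 | (a < L)%N)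
   \sum_(l : {ffun 'I_k -> 'I_m.+1} | [forall i, (l i < a)%N] && decreasing l)
     alpha (m.+1 * n + a)%N * \prod_(j < k) alpha (m.+1 * (n.+1 + j) + l j)%N);
  last first.
  by apply: eq_bigr => a _; rewrite -big_distrr /= IHk // ltnW.
rewrite pair_big_dep; apply: eq_big => [[a l]|[a l] _] /=.
  have cons0: ffcons (a, l) ord0 = a by rewrite ffunE unlift_none.
  have consS i: ffcons (a, l) (lift ord0 i) = l i by rewrite ffunE liftK.
  apply/andP/idP => [[/forallP ltL /forallP decr]|/and3P[ltaL /forallP lta /forallP decr]].
    apply/and3P; split; first by rewrite -cons0.
      by apply/forallP => i; have /forallP/(_ (lift ord0 i)) := decr ord0;
        rewrite cons0 consS.
    apply/forallP => i; apply/forallP => j; apply/implyP => ltij.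
    by have /forallP/(_ (lift ord0 j))/implyP := decr (lift ord0 i);
      rewrite !consS; apply.
  split; apply/forallP => i; case: (unliftP ord0 i) => [i'|] ->.
  - by rewrite consS (ltn_trans (lta i')).
  - by rewrite cons0.
  - apply/forallP => j; case: (unliftP ord0 j) => [j'|] -> //.
    rewrite !consS; exact: (forallP (decr i') j').
  apply/forallP => j; case: (unliftP ord0 j) => [j'|] -> //.
  by rewrite consS cons0; apply/implyP.
rewrite big_ord_recl !ffunE unlift_none addn0; congr (_ * _).
by apply: eq_bigr => i _; rewrite ffunE liftK /= addSnnS.
Qed.

Lemma gammaE k n : gamma m alpha k n = chain_sum k.+1 m.+1 n.
Proof.
rewrite -sum_decreasing //; apply: eq_bigl => l.
by rewrite (_ : [forall i, _] = true) //; apply/forallP => i; apply: ltn_ord.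
Qed.

End ChainSums.

(** Leading coefficients equal to 1 allow the top coefficient of [p] to be cancelled without
    division. *)
Lemma monic_basis_expansion (R : comNzRingType) (Q : nat -> {poly R}) :
  (forall n, Q n \is monic) -> (forall n, size (Q n) = n.+1) ->
  forall n (p : {poly R}), (size p <= n)%N ->
  exists c : nat -> R, p = \sum_(i < n) c i *: Q i.
Proof.
move=> Qmon Qsize; elim=> [|n IHn] p lepn.
  by exists (fun=> 0); rewrite big_ord0; apply/eqP; rewrite -size_poly_leq0.
have [|c def_p] := IHn (p - p`_n *: Q n).
  apply/leq_sizeP => j; rewrite leq_eqVlt => /predU1P[<-|ltnj].
    rewrite coefB coefZ.
    by have := monicP (Qmon n); rewrite lead_coefE Qsize /= => ->; rewrite mulr1 subrr.
  by rewrite coefB coefZ (leq_sizeP _ _ lepn j ltnj) [(Q n)`_j]nth_default ?Qsize // mulr0 subrr.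
exists (fun i => if i == n then p`_n else c i).
rewrite big_ord_recr /= eqxx -[LHS](subrK (p`_n *: Q n)) def_p; congr (_ + _).
by apply: eq_bigr => i _; rewrite ltn_eqF.
Qed.

(** * Polynomials attached to heights and their recurrence *)

Section HeightPolynomials.

Variables (R : comNzRingType) (m : nat) (alpha : nat -> R).
Hypothesis alpha_init : forall j : nat, (j < m)%N -> alpha j = 0.

(* height_poly h is E_h divided by t^(h mod (m+1)), as a polynomial in
   x = t^(m+1). The sequence below lists height_poly h, ..., height_poly 0. For
   h < m the default value of nth is harmless, its coefficient alpha h being 0. *)
Fixpoint height_poly_seq h : seq {poly R} :=
  if h is h'.+1 then
    let s := height_poly_seq h' in
    'X^(m.+1 %| h)%N * head 1 s - alpha h' *: nth 1 s m :: s
  else [:: 1].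

Definition height_poly h := head 1 (height_poly_seq h).

Local Notation E := height_poly.

Lemma height_polyS h :
  E h.+1 = 'X^(m.+1 %| h.+1)%N * E h - alpha h *: E (h - m).
Proof.
have nthE i j : (i <= j)%N -> nth 1 (height_poly_seq j) i = E (j - i).
  by elim: i j => [|i IHi] [|j] //= leij; rewrite IHi // subSS.
rewrite {1}/height_poly /=; congr (_ - _); case: (leqP m h) => [le_mh|lt_hm].
  by rewrite nthE.
by rewrite alpha_init // !scale0r.
Qed.

Lemma modn_subS h : (m <= h)%N -> ((h - m) %% m.+1)%N = (h.+1 %% m.+1)%N.
Proof. by move=> le_mh; rewrite -[h in RHS](subnK le_mh) -addnS modnDr. Qed.

Lemma height_poly_monic_size h :
  E h \is monic /\ size (E h) = (h %/ m.+1).+1.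
Proof.
elim/ltn_ind: h => -[_|h IHh]; first by rewrite /height_poly monic1 size_poly1 div0n.
have [Emon Esize] := IHh h (ltnSn h).
set p := 'X^(m.+1 %| h.+1)%N * E h.
have pmon : p \is monic by rewrite monicMl ?monicXn.
have psize : size p = (h.+1 %/ m.+1).+1.
  by rewrite size_monicM ?monicXn ?monic_neq0 // size_polyXn Esize divnS // addSn /= addnS.
(* For [m <= h], the quotient of [h - m] by [m.+1] is one less than that of [h.+1], so the fall term
   does not affect the leading term. *)
have qsize : (size (- (alpha h *: E (h - m))) < size p)%N.
  rewrite size_polyN psize ltnS; case: (leqP m h) => [le_mh|lt_hm].
    apply: leq_trans (size_scale_leq _ _) _.
    have [//|_ ->] := IHh (h - m)%N; first by rewrite ltnS leq_subr.
    by rewrite -[h in (h.+1 %/ _)%N](subnK le_mh) -addnS divnDr // divnn addn1.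
  by rewrite alpha_init // scale0r size_poly0.
by rewrite height_polyS size_polyDl // psize monicE lead_coefDl // -monicE.
Qed.

(* x^n times height_poly h is t^((m+1)n - h mod (m+1)) E_h; the hypothesis on h
   keeps this exponent from being truncated. *)
Lemma functional_height_poly (w : {scalar {poly R}}) t :
  (forall n, w 'X^n = path_sum m alpha (m.+1 * n) 0 t) ->
  forall n h, (h %% m.+1 <= m.+1 * n)%N ->
  w ('X^n * E h) = path_sum m alpha (m.+1 * n - h %% m.+1) h t.
Proof.
move=> wX n h; elim/ltn_ind: h n => -[_|h IHh] n le_rn.
  by rewrite mulr1 wX mod0n subn0.
(* The residue grows by 1, or drops from [m] to 0 when [m.+1] divides [h.+1]; the factor x makes up
   for the drop. *)
have def_r : (h %% m.+1 + 1 = h.+1 %% m.+1 + m.+1 * (m.+1 %| h.+1))%N.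
  have := divn_eq h m.+1; have := divn_eq h.+1 m.+1.
  by rewrite divnS // mulnDl; lia.
rewrite height_polyS mulrBr mulrA -exprD -scalerAr linearB linearZ /=.
rewrite IHh //; last by rewrite mulnDr; lia.
have ->: (m.+1 * (n + (m.+1 %| h.+1)) - h %% m.+1 = (m.+1 * n - h.+1 %% m.+1).+1)%N.
  by rewrite mulnDr; lia.
rewrite /=; case: (leqP m h) => [le_mh|lt_hm].
  by rewrite IHh ?ltnS ?leq_subr // modn_subS // addrK.
by rewrite alpha_init // !mul0r subr0 addr0.
Qed.

(** Here [f] counts the falls among [L] steps from height (m+1)n, and l_0 is the position of the
    last one: f-1 falls precede it, so it starts at height (m+1)(n+1-f) + l_0. *)
Lemma height_poly_chain n L : (L <= m)%N ->
  E (m.+1 * n) = \sum_(f < n.+1)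
    chain_sum m alpha f L (n.+1 - f) *: E (m.+1 * (n - f) + L).
Proof.
elim: L => [_|L IHL ltLm].
  rewrite big_ord_recl big1 => [|i _]; last by rewrite /= big_ord0 scale0r.
  by rewrite /= subn0 addn0 scale1r addr0.
have ndvd j : (m.+1 %| (m.+1 * j + L).+1)%N = false.
  by rewrite -addnS dvdn_addr ?dvdn_mulr // gtnNdvd.
have stepE j : E (m.+1 * j + L)
  = E (m.+1 * j + L.+1) + alpha (m.+1 * j + L)%N *: E (m.+1 * j + L - m).
  by rewrite addnS height_polyS ndvd mul1r subrK.
rewrite IHL 1?ltnW //.
under eq_bigr do rewrite stepE scalerDr.
rewrite big_split /= [X in X + _]big_ord_recl [X in _ + X]big_ord_recr /= [RHS]big_ord_recl.
(* After [n] falls the height is [L < m], so a further fall has weight 0. *)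
rewrite subnn muln0 add0n alpha_init // scale0r scaler0 addr0 -addrA; congr (_ + _).
rewrite -big_split; apply: eq_bigr => i _.
rewrite lift0 chain_sumSS scalerDl scalerA; congr (_ + _).
have lt_in := ltn_ord i; rewrite /= subSS [(alpha _ * _)]mulrC -subSn ?(ltnW lt_in) //.
by congr (_ *: E _); nia.
Qed.

Lemma chain_sum_boundary k L : (L <= m)%N -> chain_sum m alpha k.+1 L 0 = 0.
Proof.
move=> leLm; apply: big1 => a _.
by rewrite muln0 alpha_init ?mul0r // (leq_trans (ltn_ord a)).
Qed.

(** The last of the m+1 steps starts at residue [m] and completes t^(m+1) = x; whether it is a fall
    decides whether [m] is an entry of the chain. *)
Lemma height_poly_recurrence n :
  'X * E (m.+1 * n)
  = E (m.+1 * n.+1)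
    + \sum_(k < n.+1) chain_sum m alpha k.+1 m.+1 (n - k) *: E (m.+1 * (n - k)).
Proof.
have stepE j : 'X * E (m.+1 * j + m)
  = E (m.+1 * j.+1) + alpha (m.+1 * j + m)%N *: E (m.+1 * j).
  have def_j : (m.+1 * j.+1 = (m.+1 * j + m).+1)%N by lia.
  by rewrite def_j height_polyS -def_j dvdn_mulr // addnK subrK.
rewrite (height_poly_chain n (leqnn m)) mulr_sumr.
under eq_bigr do rewrite -scalerAr stepE scalerDr.
under [X in _ = _ + X]eq_bigr do rewrite chain_sumSS scalerDl.
rewrite !big_split addrA; congr (_ + _).
  rewrite [LHS]big_ord_recl [chain_sum _ _ ord0 _ _]/= subn0 scale1r.
  congr (_ + _).
  rewrite [RHS]big_ord_recr subnn chain_sum_boundary // scale0r [RHS]addr0.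
  by apply: eq_bigr => i _; rewrite lift0 subSS -subSn.
by apply: eq_bigr => i _; rewrite scalerA mulrC -subSn // -ltnS.
Qed.

End HeightPolynomials.

Theorem theorem4p5 (R : comNzRingType) (m : nat) (hm : (0 < m)%N)
  (alpha : nat -> R)
  (alpha_reg : forall k : nat, GRing.lreg (alpha (k + m)%N))
  (alpha_init : forall j : nat, (j < m)%N -> alpha j = 0)
  (u v : 'I_m -> {scalar {poly R}})
  (hu : forall (k : 'I_m) (n : nat), u k 'X^n = gen_stieltjes_rogers m alpha n k)
  (hv : forall (k : 'I_m) (n : nat), v k 'X^n = mod_stieltjes_rogers m k alpha n)
  (P : nat -> {poly R})
  (Pu : d_orthogonal u P)
  (Pv : d_orthogonal v P) :
  P 0%N = 1 /\
  forall n : nat,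
    P n.+1 = 'X * P n
             - \sum_(k < (minn m n).+1) gamma m alpha k (n - k) *: P (n - k)%N.
Proof.
pose Q n := height_poly m alpha (m.+1 * n).
have [PmonS Port] := Pu.
have Qmon n : Q n \is monic by have [] := height_poly_monic_size alpha_init (m.+1 * n).
have Qsize n : size (Q n) = n.+1.
  by have [_ ->] := height_poly_monic_size alpha_init (m.+1 * n); rewrite mulKn.
have uQ j k n : u j ('X^k * Q n) = path_sum m alpha (m.+1 * k) (m.+1 * n) (m.+1 * j).
  rewrite (functional_height_poly alpha_init (t := m.+1 * j)) ?modnMr ?subn0 // => i.
  by rewrite hu /gen_stieltjes_rogers mdyck_sumE //= subn0.
have PQ n : P n = Q n.
  have [/monicP Pmon Psize] := PmonS n.
  have [|c def_c] := @monic_basis_expansion _ _ Qmon Qsize n (P n - Q n).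
    apply/leq_sizeP => j; rewrite coefB leq_eqVlt => /predU1P[<-|ltnj].
      have := monicP (Qmon n).
      by move: Pmon; rewrite !lead_coefE Qsize Psize /= => -> ->; rewrite subrr.
    by rewrite !nth_default ?subrr ?Qsize ?Psize.
  apply/eqP; rewrite -subr_eq0 def_c; apply/eqP.
  suff c0 i : (i < n)%N -> c i = 0 by apply: big1 => i _; rewrite c0 ?scale0r.
  elim/ltn_ind: i => i IHi lt_in.
  (* With i = mk + j, the functional u_j[x^k .] isolates [c i]: terms with [l < i] vanish by
     induction, those with [i < l] start too high, and the factor at [l = i] is regular. *)
  pose j := Ordinal (ltn_pmod i hm); pose k := (i %/ m)%N.
  have def_i : i = (m * k + j)%N by rewrite mulnC -divn_eq.
  have: u j ('X^k * (P n - Q n)) = 0.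
    rewrite mulrBr linearB /= uQ path_sum_small ?subr0; last by nia.
    by apply: (Port j k n).2; rewrite addn1 -def_i.
  rewrite def_c mulr_sumr linear_sum /= (bigD1 (Ordinal lt_in)) //= big1 => [|l neq_li].
    rewrite addr0 -scalerAr linearZ /= uQ => ci0.
    have := @path_sum_lreg _ _ _ alpha_reg (m.+1 * k) (m.+1 * j).
    rewrite (_ : m.+1 * j + _ = m.+1 * i)%N; last by nia.
    by apply; rewrite mulr0 mulrC.
  rewrite -scalerAr linearZ /= uQ; case: (ltngtP l i) => [lt_li|lt_il|eq_li].
  - by rewrite IHi ?mul0r // (ltn_trans lt_li).
  - by rewrite path_sum_small ?mulr0 //; nia.
  - by case/eqP: neq_li; apply: val_inj.
split=> [|n]; first by rewrite PQ /Q muln0.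
apply/esym/eqP; rewrite subr_eq; apply/eqP.
rewrite !PQ /Q height_poly_recurrence //; congr (_ + _).
have le_mn : ((minn m n).+1 <= n.+1)%N by rewrite ltnS geq_minr.
(* The added terms have [m < k] and vanish: k+1 decreasing entries do not fit in [m.+1] values. *)
rewrite (big_ord_widen _ (fun k => gamma m alpha k (n - k) *: P (n - k)%N) le_mn).
rewrite [RHS]big_mkcond.
apply: eq_bigr => k _; rewrite gammaE PQ; case: ifPn => // ltk.
by rewrite chain_sum_small ?scale0r //; move: (ltn_ord k) ltk; lia.
Qed.
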